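(* Let $P$ be a finite metacyclic $2$-group which is neither of maximal class nor homocyclic. Then every fusion system $\mathcal{F}$ on $P$ is nilpotent, i.e. $\operatorname{Aut}_{\mathcal{F}}(Q)$ is a $2$-group for every subgroup $Q\le P$.
   Context: A group is metacyclic if it has a cyclic normal subgroup with cyclic quotient. A homocyclic group here means a direct product of two isomorphic cyclic groups. The $2$-groups of maximal class are precisely the dihedral groups (order $\ge 8$), the semidihedral groups (order $\ge 16$) and the (generalized) quaternion groups (order $\ge 8$). Fusion systems are understood to be saturated. Explicitly, let $p$ be a prime and $P$ a finite $p$-group. A fusion system $\mathcal{F}$ on $P$ is a category whose objects are the subgroups of $P$, and whose morphism sets $\operatorname{Hom}_{\mathcal{F}}(Q,R)$ consist of injective group homomorphisms $Q\to R$, with composition of morphisms the usual composition of maps, such that: (i) for all $Q,R\le P$, every homomorphism $Q\to R$ of the form $u\mapsto xux^{-1}$ with $x\in P$ and $xQx^{-1}\le R$ lies in $\operatorname{Hom}_{\mathcal{F}}(Q,R)$; (ii) for every $\varphi\in\operatorname{Hom}_{\mathcal{F}}(Q,R)$ the induced isomorphism $Q\to\varphi(Q)$ and its inverse are morphisms in $\mathcal{F}$; (iii) $\operatorname{Aut}_P(P)$, the group of inner automorphisms of $P$, is a Sylow $p$-subgroup of $\operatorname{Aut}_{\mathcal{F}}(P)$; (iv) every morphism $\varphi:Q\to P$ in $\mathcal{F}$ such that $\varphi(Q)$ is fully $\mathcal{F}$-normalized extends to a morphism $N_\varphi\to P$ in $\mathcal{F}$, where $N_\varphi=\{y\in \operatorname{N}_P(Q)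 : \exists z\in \operatorname{N}_P(\varphi(Q)) \text{ with } \varphi(yuy^{-1})=z\varphi(u)z^{-1}\ \forall u\in Q\}$. Here $R\le P$ is fully $\mathcal{F}$-normalized if $|\operatorname{N}_P(R)|\ge|\operatorname{N}_P(R')|$ for every $R'\le P$ isomorphic to $R$ in $\mathcal{F}$. We write $\operatorname{Aut}_{\mathcal{F}}(Q)=\operatorname{Hom}_{\mathcal{F}}(Q,Q)$. The fusion system $\mathcal{F}$ is called nilpotent if $\operatorname{Aut}_{\mathcal{F}}(Q)$ is a $p$-group for every $Q\le P$. *)

(* Defs.v *)
From mathcomp Require Import all_boot all_fingroup all_solvable.

Set Implicit Arguments.
Unset Strict Implicit.
Unset Printing Implicit Defensive.

Local Open Scope group_scope.

(* A family [hom] of morphism sets: [hom Q R f] says that the restriction to Q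
   of the function [f] is a morphism Q -> R of the category.  Left conjugation
   u |-> x u x^-1 is written out, as the library's [u ^ x] is x^-1 u x. *)
Definition hom_family (gT : finGroupType) :=
  {group gT} -> {group gT} -> pred (gT -> gT).

Section HomFamily.

Variables (gT : finGroupType) (hom : hom_family gT) (P : {group gT}).
Implicit Types (Q R S : {group gT}) (f g : gT -> gT).

(* <<f @: Q>> is just f @: Q when f is multiplicative on Q (lemma [fimgE]). *)
Definition fimg f Q : {group gT} := [group of <<f @: Q>>].

Lemma fimgE f Q :
  {in Q &, {morph f : x y / x * y}} -> fimg f Q = f @: Q :> {set gT}.
Proof.
by move=> fM; rewrite /= -[f @: Q](morphimEdom (@Morphism _ _ Q f fM)) genGid.
Qed.

Definition fiso Q R : Prop :=
  exists f g, [/\ hom Q R f, hom R Q g, {in Q, cancel f g} & {in R, cancel g f}].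

Definition fully_normalized R : Prop :=
  R \subset P /\
  forall R', R' \subset P -> fiso R R' -> (#|'N_P(R')| <= #|'N_P(R)|)%N.

(* The subgroup N_f of the extension axiom. *)
Definition extension_dom Q f : {set gT} :=
  [set y in 'N_P(Q) | [exists z in 'N_P(f @: Q), forall u in Q,
     f (y * u * y^-1) == z * f u * z^-1]].

Lemma extension_dom_group_set Q f : group_set (extension_dom Q f).
Proof.
apply/group_setP; split=> [|x y].
  rewrite inE group1; apply/existsP; exists 1; rewrite group1 /=.
  by apply/forall_inP=> u _; rewrite invg1 !mul1g !mulg1.
case/setIdP=> [Nx /exists_inP[x' Nx' /forall_inP fx]].
case/setIdP=> [Ny /exists_inP[y' Ny' /forall_inP fy]].
rewrite inE groupM //=.
apply/exists_inP; exists (x' * y'); first exact: groupM.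
apply/forall_inP=> u Qu; rewrite !invMg !mulgA.
have Qyu: y * u * y^-1 \in Q.
  have /setIP[_ Ny1] := Ny.
  by rewrite -mulgA -{1}[y]invgK -conjgE memJ_norm ?groupV.
by have /eqP := fx _ Qyu; rewrite (eqP (fy _ Qu)) !mulgA => <-.
Qed.
Canonical extension_dom_group Q f := Group (extension_dom_group_set Q f).

(* Elements of Aut Q fix everything outside Q, so automorphisms of Q in the
   category correspond to exactly one permutation each. *)
Definition AutF Q : {set {perm gT}} := [set a in Aut Q | hom Q Q a].

End HomFamily.

Record fusion_system (p : nat) (gT : finGroupType) (P : {group gT}) := Fusion {
  fhom :> hom_family gT;
  (* morphisms only exist between subgroups of P *)
  fhom_sub : forall (Q R : {group gT}) f, fhom Q R f -> Q \subset P /\ R \subset P;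
  fhom_inj : forall (Q R : {group gT}) f, fhom Q R f ->
    [/\ {in Q &, {morph f : x y / x * y}}, {in Q &, injective f}
      & f @: Q \subset R];
  fhom_eq : forall (Q R : {group gT}) f g,
    {in Q, f =1 g} -> fhom Q R f -> fhom Q R g;
  fhom_comp : forall (Q R S : {group gT}) f g,
    fhom Q R f -> fhom R S g -> fhom Q S (g \o f);
  (* the case x = 1 also provides the identities *)
  fhom_conj : forall (Q R : {group gT}) x, Q \subset P -> R \subset P -> x \in P ->
    [set x * u * x^-1 | u in Q] \subset R -> fhom Q R (fun u => x * u * x^-1);
  fhom_img : forall (Q R : {group gT}) f, fhom Q R f -> fhom Q (fimg f Q) f;
  fhom_inv : forall (Q R : {group gT}) f g, fhom Q R f ->
    {in Q, cancel f g} -> fhom (fimg f Q) Q g;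
  fhom_Sylow : p.-Sylow(AutF fhom P) (conj_aut P @* P);
  fhom_extend : forall (Q : {group gT}) f, fhom Q P f ->
    fully_normalized fhom P (fimg f Q) ->
    exists2 g, fhom [group of extension_dom P Q f] P g & {in Q, f =1 g}
}.

Lemma AutF_group_set (p : nat) (gT : finGroupType) (P Q : {group gT})
  (F : fusion_system p P) : Q \subset P -> group_set (AutF F Q).
Proof.
move=> sQP; apply/group_setP; split=> [|a b].
  rewrite inE group1; apply: (fhom_eq (f := fun u => 1 * u * 1^-1)) => [u _|].
    by rewrite perm1 invg1 mul1g mulg1.
  apply: fhom_conj => //; apply/subsetP=> _ /imsetP[u Qu ->].
  by rewrite invg1 mul1g mulg1.
case/setIdP=> Aa Fa /setIdP[Ab Fb]; rewrite inE groupM //=.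
by apply: fhom_eq (fhom_comp Fa Fb) => u _; rewrite permM.
Qed.

Definition fusion_nilpotent (p : nat) (gT : finGroupType) (P : {group gT})
    (F : fusion_system p P) : Prop :=
  forall Q : {group gT}, Q \subset P -> p.-group (AutF F Q).

(* The bound 2 < n excludes the groups of order p ^ 2 (so that a 2-group of
   maximal class is dihedral, semidihedral or quaternion, of order >= 8). *)
Definition maximal_class (p : nat) (gT : finGroupType) (G : {group gT}) : Prop :=
  exists n, [/\ (2 < n)%N, #|G| = (p ^ n)%N & nil_class G = n.-1].

(* Unlike the library's [homocyclic], this has exactly two cyclic factors. *)
Definition homocyclic2 (gT : finGroupType) (G : {group gT}) : Prop :=
  exists A B : {group gT}, [/\ cyclic A, cyclic B, A \isog B & A \x B = G].

(* Main.v *)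
Require Import Defs.
From mathcomp Require Import all_boot all_fingroup all_solvable.

(** Two facts are combined: a reduction valid for every saturated fusion system
    on a p-group, and the rigidity of automorphisms of odd order of metacyclic
    2-groups.

    Reduction [fusion_nilpotent_criterion].  By downward induction on the order,
    a fully normalized Q has no other automorphisms in F than those induced by
    N_P(Q), as soon as Aut_F(Q) is known to be a p-group; and this has to be
    checked only for those Q that contain their centralizer in P and, when
    Q < P, for which the group [normAut P Q] of automorphisms induced by N_P(Q)
    is self-normalizing in Aut_F(Q).  Indeed, if C_P(Q) is not contained in Q,
    every automorphism of Q extends to the larger group Q C_P(Q), where only
    p-elements are available ([AutF_centric]); and an automorphism normalizing
    [normAut P Q] extends to N_P(Q) > Q, where by induction it is, up to
    F-conjugation, induced by an element of P; comparing orders of normalizers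
    puts this element back into N_P(Q) ([normAut_self_normalizing]).

    Rigidity.  Let X be a cyclic normal subgroup of the 2-group P with P / X
    cyclic, and let a be an automorphism of odd prime order of Q <= P.  As Q is
    generated by two elements, a moves every subgroup of index 2 of Q
    ([odd_aut_moves_index2]).  If x generates the intersection of X and Q, it
    follows that Q is generated by x and a x, two elements with normal cyclic
    spans.  Were these spans to intersect nontrivially, a power map would in
    most cases be an endomorphism of Q with a kernel of index 2, which is
    impossible ([power_morphism_TI]).  So either Q is the direct product of
    <[x]> and <[a x]>, or x has order 4 and is moved by a x ([Aut_image_dichotomy]).
    In the second case a x does not centralize the subgroup of order 4 of X, so
    it cannot be a square modulo X; hence it generates P modulo X, and P has
    maximal class ([maximal_class_criterion]).

    Conclusion.  There remains the case where Q is homocyclic, contains its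
    centralizer, and is smaller than P, as P itself is not homocyclic.  If x has
    order 2, the criterion above again makes P a group of maximal class
    ([centric_four_group]).  Otherwise let K be the group of automorphisms in
    Aut_F(Q) acting trivially on the Frattini quotient of Q.  It is a normal
    2-subgroup, hence is contained in the self-normalizing [normAut P Q]; its
    elements therefore act trivially modulo <[x]> and, by conjugation with a,
    modulo <[a x]>, so that K = 1 ([Phi_kernel_trivial]).  This forces an element
    g of N_P(Q) outside Q to invert x and to satisfy g^2 \in Q and
    (a x)^g = (a x) x^i with i odd, which is incompatible with P / X being
    cyclic ([homocyclic_critical_contra]). *)

Set Implicit Arguments.
Unset Strict Implicit.
Unset Printing Implicit Defensive.

Local Open Scope group_scope.

(** * Automorphisms induced by the ambient group *)

Definition normAut {gT : finGroupType} (P Q : {group gT}) : {group {perm gT}} :=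
  (conj_aut Q @* 'N_P(Q))%G.

Lemma normAutP {gT : finGroupType} {P Q : {group gT}} {s : {perm gT}} :
  reflect (exists y, [/\ y \in 'N_P(Q), s \in Aut Q
                       & {in Q, forall u, s u = u ^ y}])
          (s \in normAut P Q).
Proof.
apply: (iffP idP) => [/morphimP[y Ny NPy ->] | [y [NPy As sE]]].
  exists y; split=> // [|u Qu]; last by rewrite norm_conj_autE.
  exact: subsetP (Aut_conj_aut Q 'N(Q)) _ (mem_morphim _ Ny Ny).
have Ny : y \in 'N(Q) by case/setIP: NPy.
have -> : s = conj_aut Q y; last exact: mem_morphim.
apply: (eq_Aut As); last by move=> u Qu; rewrite /= norm_conj_autE ?sE.
exact: subsetP (Aut_conj_aut Q 'N(Q)) _ (mem_morphim _ Ny Ny).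
Qed.

Lemma not_pgroup_prime_elt (p : nat) (gT : finGroupType) (G : {group gT}) :
  ~~ p.-group G -> exists2 x, x \in G & prime #[x] /\ #[x] != p.
Proof.
rewrite /pgroup /pnat cardG_gt0 /= => /allPn[q].
rewrite mem_primes => /and3P[pr_q _ q_dv] qp.
by have [x Gx ox] := Cauchy pr_q q_dv; exists x; rewrite ?ox.
Qed.

Lemma Aut_expE {gT : finGroupType} {Q : {group gT}} {a : {perm gT}} n u :
  a \in Aut Q -> u \in Q -> (a ^+ n) u \in Q.
Proof. by move=> Aa; apply: Aut_closed; rewrite groupX. Qed.

(** The order of an automorphism can only grow when it is extended or
    transported along an embedding: both situations have this form. *)
Lemma order_dvd_intertwine {gT : finGroupType} {Q : {group gT}}
    (f : gT -> gT) (a b : {perm gT}) :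
    {in Q &, injective f} -> a \in Aut Q ->
    {in Q, forall u, b (f u) = f (a u)} -> #[a] %| #[b].
Proof.
move=> injf Aa fab.
have fabX n u : u \in Q -> (b ^+ n) (f u) = f ((a ^+ n) u).
  move=> Qu; elim: n => [|n IHn]; first by rewrite !perm1.
  by rewrite !expgSr !permM IHn fab ?Aut_expE.
rewrite order_dvdn; apply/eqP/(@eq_Aut _ Q); rewrite ?groupX ?group1 // => u Qu.
by rewrite perm1; apply: injf; rewrite ?Aut_expE // -fabX // expg_order perm1.
Qed.

(** * Morphisms of a fusion system *)

Section FusionMorphisms.

Variables (p : nat) (gT : finGroupType) (P : {group gT}).
Variable F : fusion_system p P.
Local Notation hom := (fhom F).
Implicit Types (Q R S : {group gT}) (f g : gT -> gT).

Lemma fimg_val Q R f : hom Q R f -> fimg f Q = f @: Q :> {set gT}.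
Proof. by case/fhom_inj=> fM _ _; exact: fimgE. Qed.

Lemma mem_fimg Q R f u : hom Q R f -> u \in Q -> f u \in fimg f Q.
Proof. by move=> Ff Qu; rewrite (fimg_val Ff) imset_f. Qed.

Lemma fhom1 Q R f : hom Q R f -> f 1 = 1.
Proof.
case/fhom_inj=> fM _ _; apply: (mulgI (f 1)).
by rewrite -fM ?group1 // !mulg1.
Qed.

Lemma fhomV Q R f u : hom Q R f -> u \in Q -> f u^-1 = (f u)^-1.
Proof.
move=> Ff Qu; have [fM _ _] := fhom_inj Ff; apply: (mulgI (f u)).
by rewrite -fM ?groupV // !mulgV (fhom1 Ff).
Qed.

Lemma fhomJ Q R f u v : hom Q R f -> u \in Q -> v \in Q -> f (u ^ v) = f u ^ f v.
Proof.
move=> Ff Qu Qv; have [fM _ _] := fhom_inj Ff.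
by rewrite !conjgE !fM ?groupM ?groupV // (fhomV Ff).
Qed.

Lemma fhom_incl Q R : Q \subset R -> R \subset P -> hom Q R id.
Proof.
move=> sQR sRP.
apply: (@fhom_eq _ _ _ F _ _ (fun u => 1 * u * 1^-1)).
  by move=> u _; rewrite invg1 mul1g mulg1.
apply: fhom_conj => //; first exact: subset_trans sRP.
by apply/subsetP=> _ /imsetP[u Qu ->]; rewrite invg1 mul1g mulg1 (subsetP sQR).
Qed.

Lemma fhom_restrict Q R Q' R' f : hom Q R f -> Q' \subset Q -> R' \subset P ->
  f @: Q' \subset R' -> hom Q' R' f.
Proof.
move=> Ff sQ'Q sR'P sfR'; have [sQP _] := fhom_sub Ff.
have Ff' : hom Q' R f by apply: (fhom_comp (fhom_incl sQ'Q sQP) Ff).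
have sf : fimg f Q' \subset R' by rewrite (fimg_val Ff').
exact: (fhom_comp (fhom_img Ff') (fhom_incl sf sR'P)).
Qed.

Lemma fhom_cancel Q R f : hom Q R f ->
  exists2 g, hom (fimg f Q) Q g & {in Q, cancel f g}.
Proof.
move=> Ff; have [_ injf _] := fhom_inj Ff.
pose g v := odflt 1 [pick u in Q | f u == v].
have fK : {in Q, cancel f g}.
  move=> u Qu; rewrite /g; case: pickP => [v /andP[Qv /eqP fuv] | /(_ u)].
    exact/esym/injf.
  by rewrite Qu eqxx.
by exists g; first exact: fhom_inv Ff fK.
Qed.

Lemma fimg_fiso Q R f : hom Q R f -> fiso F Q (fimg f Q).
Proof.
move=> Ff; have [g Fg fK] := fhom_cancel Ff.
exists f, g; split=> //; first exact: fhom_img Ff.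
by move=> v; rewrite (fimg_val Ff) => /imsetP[u Qu ->]; rewrite fK.
Qed.

Lemma card_fimg Q R f : hom Q R f -> #|fimg f Q| = #|Q|.
Proof.
by move=> Ff; rewrite (fimg_val Ff) card_in_imset //; case: (fhom_inj Ff).
Qed.

Lemma fhom_AutF Q f : hom Q Q f -> exists2 a, a \in AutF F Q & {in Q, a =1 f}.
Proof.
move=> Ff; have [fM injf sfQ] := fhom_inj Ff.
pose fm := Morphism fM.
have injfm : 'injm fm by apply/injmP=> u v; apply: injf.
have fQ : fm @* Q = Q.
  by apply/eqP; rewrite eqEcard card_injm // leqnn andbT morphimEdom.
have aE := autE injfm fQ; exists (aut injfm fQ) => //.
rewrite inE Aut_aut; apply: fhom_eq Ff => u Qu; exact/esym/aE.
Qed.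

Lemma AutF_hom {Q a} : a \in AutF F Q -> hom Q Q a.
Proof. by case/setIdP. Qed.

Lemma AutF_Aut {Q a} : a \in AutF F Q -> a \in Aut Q.
Proof. by case/setIdP. Qed.

(** F-conjugate subgroups have the same automorphisms, which is how statements
    about fully normalized subgroups reach all the others. *)
Lemma AutF_transport Q R f a : hom Q R f -> a \in AutF F Q ->
  exists2 b, b \in AutF F (fimg f Q) & {in Q, forall u, b (f u) = f (a u)}.
Proof.
move=> Ff AFa; have [g Fg fK] := fhom_cancel Ff.
have [b AFb bE] := fhom_AutF
  (fhom_comp (fhom_comp Fg (AutF_hom AFa)) (fhom_img Ff)).
by exists b => // u Qu; rewrite bE ?(mem_fimg Ff) //= fK.
Qed.

Lemma normAut_sub_AutF Q : Q \subset P -> normAut P Q \subset AutF F Q.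
Proof.
move=> sQP; apply/subsetP=> s /normAutP[y [/setIP[Py Ny] As sE]].
rewrite inE As /=; apply: (@fhom_eq _ _ _ F _ _ (fun u => y^-1 * u * y^-1^-1)).
  by move=> u Qu; rewrite sE // invgK conjgE mulgA.
apply: fhom_conj; rewrite ?groupV //.
apply/subsetP=> _ /imsetP[u Qu ->].
by rewrite invgK -mulgA -conjgE memJ_norm.
Qed.

(** Conjugates of Q are the images of the finitely many morphisms from Q to P,
    so one of them has a normalizer of largest order. *)
Lemma fully_normalized_fimg Q : Q \subset P ->
  exists2 f, hom Q P f & fully_normalized F P (fimg f Q).
Proof.
move=> sQP.
pose f0 : {ffun gT -> gT} := [ffun x => x].
have F1 : hom Q P f0.
  by apply: fhom_eq (fhom_incl sQP (subxx P)) => u _; rewrite ffunE.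
case: (@arg_maxnP _ f0 (fun f : {ffun gT -> gT} => hom Q P f)
  (fun f : {ffun gT -> gT} => #|'N_P(fimg f Q)|) F1) => f Ff maxf.
exists f => //; split=> [|R' sR'P [h [h' [Fh Fh' hK h'K]]]].
  by have [_ _] := fhom_inj Ff; rewrite (fimg_val Ff).
have Fhf := fhom_comp (fhom_img Ff) Fh.
have Fk : hom Q P (finfun (h \o f)).
  have Fid := fhom_incl sR'P (subxx P).
  by apply: fhom_eq (fhom_comp Fhf Fid) => u _; rewrite ffunE.
suffices {1}->: R' = fimg (finfun (h \o f)) Q by exact: maxf.
apply/val_inj; rewrite /= (fimg_val Fk); apply/setP=> v.
apply/idP/imsetP=> [R'v | [u Qu ->]]; last first.
  rewrite ffunE; have [_ _ /subsetP] := fhom_inj Fhf; apply.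
  exact: imset_f.
have [_ _ sh'] := fhom_inj Fh'.
have /imsetP[u Qu h'v] : h' v \in f @: Q.
  by rewrite -(fimg_val Ff) (subsetP sh') ?imset_f.
by exists u; rewrite // ffunE /= -h'v h'K.
Qed.

End FusionMorphisms.

(** * Extending automorphisms to larger subgroups *)

Section FusionExtension.

Variables (p : nat) (gT : finGroupType) (P : {group gT}).
Variable F : fusion_system p P.
Local Notation hom := (fhom F).
Implicit Types (Q R S : {group gT}) (f g : gT -> gT).

Lemma AutF_prime_elt Q : Q \subset P -> ~~ p.-group (AutF F Q) ->
  exists2 a, a \in AutF F Q & prime #[a] /\ #[a] != p.
Proof.
move=> sQP.
exact: (@not_pgroup_prime_elt p _ (Group (AutF_group_set F sQP))).
Qed.

Lemma AutF_fimg Q a : a \in AutF F Q -> a @: Q = Q.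
Proof.
case/setIdP=> Aa _; apply/eqP; rewrite eqEcard card_imset ?leqnn ?andbT.
  by apply/subsetP=> _ /imsetP[u Qu ->]; apply: Aut_closed.
exact: perm_inj.
Qed.

(** The extension axiom only yields a morphism from R to P; the last premise
    turns it into an automorphism of R. *)
Lemma AutF_extend Q R a :
    a \in AutF F Q -> fully_normalized F P Q -> Q \subset R ->
    R \subset extension_dom P Q a ->
    (forall g, hom R P g -> {in Q, a =1 g} -> g @: R \subset R) ->
  exists2 b, b \in AutF F R & {in Q, a =1 b}.
Proof.
move=> AFa fnQ sQR sRN gR; have [sQP _] := fnQ.
have homa : hom Q P a.
  exact: fhom_comp (AutF_hom AFa) (fhom_incl F sQP (subxx P)).
have aQ : fimg a Q = Q by apply/val_inj; rewrite /= (fimg_val homa) AutF_fimg.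
have [|g Fg ga] := @fhom_extend _ _ _ F Q a homa; first by rewrite aQ.
have sRP : R \subset P.
  by apply: subset_trans sRN _; apply/subsetP=> y /setIdP[/setIP[]].
have Fg' : hom R P g.
  apply: (fhom_restrict Fg sRN (subxx P) _); have [_ _] := fhom_inj Fg.
  by apply: subset_trans; apply: imsetS.
have [|b AFb bE] := @fhom_AutF _ _ _ F R g.
  exact: fhom_restrict Fg' (subxx R) sRP (gR g Fg' ga).
by exists b => // u Qu; rewrite bE ?ga // (subsetP sQR).
Qed.

Lemma extend_img_stable Q a g R u :
  a \in AutF F Q -> hom R P g -> Q \subset R -> {in Q, a =1 g} ->
  u \in Q -> g u \in Q.
Proof.
by move=> /AutF_Aut Aa Fg sQR ga Qu; rewrite -ga //; apply: Aut_closed.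
Qed.

Lemma extend_norm Q a g R v :
  a \in AutF F Q -> hom R P g -> Q \subset R -> {in Q, a =1 g} ->
  v \in R -> v \in 'N(Q) -> g v \in 'N_P(Q).
Proof.
move=> AFa Fg sQR ga Rv Nv; have [_ _ sgP] := fhom_inj Fg.
rewrite inE (subsetP sgP) ?imset_f //=.
rewrite inE; apply/subsetP=> _ /imsetP[u Qu ->].
rewrite -(AutF_fimg AFa) in Qu; case/imsetP: Qu => w Qw ->.
rewrite ga // -(fhomJ Fg) // ?(subsetP sQR) //.
by apply: (extend_img_stable AFa Fg) => //; rewrite memJ_norm.
Qed.

(** For an automorphism a of Q, the condition defining the extension domain says
    that a conjugates c_y into [normAut P Q]. *)
Lemma norm_extension_dom Q a : a \in AutF F Q -> Q \subset P ->
  a \in 'N(normAut P Q) -> 'N_P(Q) \subset extension_dom P Q a.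
Proof.
move=> AFa sQP Na; apply/subsetP=> y NPy; rewrite inE NPy AutF_fimg //=.
have [Py Ny] := setIP NPy.
have NVy : y^-1 \in 'N(Q) by rewrite groupV.
have Sc : conj_aut Q y^-1 \in normAut P Q by rewrite mem_morphim ?groupV.
have : conj_aut Q y^-1 ^ a \in normAut P Q by rewrite memJ_norm.
case/normAutP=> z [NPz _ zE]; apply/exists_inP; exists z^-1; rewrite ?groupV //.
apply/forall_inP=> u Qu; apply/eqP.
have Qau : a u \in Q by apply: Aut_closed (AutF_Aut AFa) _ Qu.
rewrite -[RHS]mulgA invgK -conjgE -zE // permJ norm_conj_autE //.
by rewrite conjgE invgK mulgA.
Qed.

(** Elements of Q and of C_P(Q) induce inner, respectively trivial, automorphisms
    of Q, and any automorphism sends these to automorphisms of the same kind. *)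
Lemma cent_extension_dom Q a : a \in AutF F Q -> Q \subset P ->
  Q <*> 'C_P(Q) \subset extension_dom P Q a.
Proof.
move=> AFa sQP; have Aa := AutF_Aut AFa.
rewrite join_subG; apply/andP; split; apply/subsetP=> y Qy; rewrite inE.
  have Ny : y \in 'N_P(Q) by rewrite inE (subsetP sQP) // (subsetP (normG Q)).
  rewrite Ny AutF_fimg //; apply/exists_inP; exists (a y).
    by rewrite inE (subsetP sQP) ?(subsetP (normG Q)) ?Aut_closed.
  apply/forall_inP=> u Qu; have [fM _ _] := fhom_inj (AutF_hom AFa).
  by rewrite !fM ?groupM ?groupV // (fhomV (AutF_hom AFa)).
have [Py Cy] := setIP Qy.
rewrite inE Py (subsetP (cent_sub Q)) //=.
apply/exists_inP; exists 1; first exact: group1.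
apply/forall_inP=> u Qu; rewrite invg1 mul1g mulg1.
by rewrite (centP Cy) // mulgK.
Qed.

(** Every automorphism of Q extends to Q C_P(Q), because a morphism that stabilizes
    Q also stabilizes the centralizer of Q.  The automorphisms of this larger
    group are p-elements, hence so are those of Q. *)
Lemma AutF_centric Q : fully_normalized F P Q ->
    ~~ ('C_P(Q) \subset Q) ->
    (forall R, fully_normalized F P R -> #|Q| < #|R| -> p.-group (AutF F R)) ->
  p.-group (AutF F Q).
Proof.
move=> fnQ ncQ IH; have [sQP _] := fnQ.
pose M := (Q <*> 'C_P(Q))%G.
have sQM : Q \subset M by apply: joing_subl.
have sMP : M \subset P by rewrite join_subG sQP subsetIl.
have ltQM : #|Q| < #|M|.
  apply: proper_card; rewrite properE sQM; apply: contra ncQ.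
  by apply: subset_trans; apply: joing_subr.
apply: contraT => /(AutF_prime_elt sQP)[a AFa [pr_a a_p]].
have [g Fg ga | b AFb ab] := AutF_extend AFa fnQ sQM (cent_extension_dom AFa sQP).
  have [gM _ sgP] := fhom_inj Fg.
  pose gm := Morphism gM.
  have -> : g @: M = gm @* M by rewrite morphimEdom.
  rewrite morphimY ?subxx //= ?join_subG ?joing_subl ?joing_subr //.
  apply/andP; split; apply/subsetP=> _ /morphimP[u Mu Qu ->].
    by rewrite /= (subsetP sQM) // (extend_img_stable AFa Fg).
  have [Pu Cu] := setIP Qu.
  rewrite (subsetP (joing_subr _ _)) //= inE (subsetP sgP) ?imset_f //=.
  apply/centP=> v; rewrite -(AutF_fimg AFa) => /imsetP[w Qw ->].
  rewrite ga //; have Mw := subsetP sQM w Qw.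
  by rewrite /commute -!gM // (centP Cu).
have [f Ff fnR] := fully_normalized_fimg F sMP.
have [c AFc cE] := AutF_transport Ff AFb.
have pA := IH _ fnR; rewrite (card_fimg Ff) in pA.
have p_c : p.-elt c.
  have sRP : fimg f M \subset P by case: fnR.
  exact: (@mem_p_elt _ _ _ (Group (AutF_group_set F sRP)) (pA ltQM) AFc).
have da : #[a] %| #[c].
  apply: dvdn_trans (order_dvd_intertwine (Q := M) (f := f) (b := c) _ _ _).
  - apply: (order_dvd_intertwine (f := id)) (AutF_Aut AFa) _ => [u v //|u Qu].
    by rewrite ab.
  - by have [] := fhom_inj Ff.
  - exact: AutF_Aut AFb.
  - exact: cE.
by have := pnat_dvd da p_c; rewrite pnatE // inE (negPf a_p).
Qed.

(** Extend a to N = N_P(Q) and transport it to a fully normalized conjugate N' of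
    N, where it becomes conjugation by some x in P.  This x normalizes the image
    of Q, whose normalizer is no larger than N since Q is fully normalized; so
    that normalizer is N', and x comes from an element of N. *)
Lemma normAut_self_normalizing Q : fully_normalized F P Q -> Q \proper P ->
    prime p -> p.-group P ->
    (forall R, fully_normalized F P R -> #|Q| < #|R| ->
       AutF F R \subset normAut P R) ->
  'N_(AutF F Q)(normAut P Q) \subset normAut P Q.
Proof.
move=> fnQ prQP pr_p pP IH; have sQP := proper_sub prQP.
apply/subsetP=> a /setIP[AFa Na].
pose N := 'N_P(Q)%G.
have sQN : Q \subset N by rewrite subsetI sQP normG.
have sNP : N \subset P by apply: subsetIl.
have ltQN : #|Q| < #|N|.
  by apply: proper_card; apply: nilpotent_proper_norm (pgroup_nil pP) prQP.
have [g Fg ga | b AFb ab] :=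
    AutF_extend AFa fnQ sQN (norm_extension_dom AFa sQP Na).
  apply/subsetP=> _ /imsetP[v Nv ->].
  by apply: (extend_norm AFa Fg) => //; case/setIP: Nv.
have [f Ff fnR] := fully_normalized_fimg F sNP.
have [fM injf _] := fhom_inj Ff.
have [c AFc cE] := AutF_transport Ff AFb.
have ltQR : #|Q| < #|fimg f N| by rewrite (card_fimg Ff).
have /normAutP[x [/setIP[Px _] _ xE]] := subsetP (IH _ fnR ltQR) c AFc.
have FfQ : hom Q P f.
  apply: (fhom_restrict Ff sQN (subxx P) _).
  have [_ _] := fhom_inj Ff; apply: subset_trans; exact: imsetS.
have fQ := fimg_val FfQ.
have sfN : fimg f N \subset 'N_P(fimg f Q).
  have [_ _ sfP] := fhom_inj Ff.
  apply/subsetP=> v; rewrite (fimg_val Ff) => /imsetP[w Nw ->].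
  rewrite inE (subsetP sfP) ?imset_f //=.
  rewrite inE; apply/subsetP=> _ /imsetP[u fQu ->].
  move: fQu; rewrite !fQ => /imsetP[u' Qu' ->].
  rewrite -(fhomJ Ff (subsetP sQN _ Qu') Nw) imset_f // memJ_norm //.
  by case/setIP: Nw.
have fNE : 'N_P(fimg f Q) = fimg f N.
  apply/eqP; rewrite eq_sym eqEcard sfN (card_fimg Ff).
  have [_ maxN] := fnQ; apply: maxN; last exact: fimg_fiso FfQ.
  by rewrite fQ; have [_ _] := fhom_inj FfQ.
have xfE u : u \in Q -> f u ^ x = f (a u).
  move=> Qu; have Nu := subsetP sQN u Qu.
  by rewrite -xE ?(mem_fimg Ff) // cE // -ab.
have : x \in 'N_P(fimg f Q).
  rewrite inE Px inE; apply/subsetP=> _ /imsetP[u fQu ->].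
  move: fQu; rewrite !fQ => /imsetP[u' Qu' ->].
  by rewrite xfE // imset_f // Aut_closed // (AutF_Aut AFa).
rewrite fNE (fimg_val Ff) => /imsetP[y Ny xy].
apply/normAutP; exists y; split=> //; first exact: AutF_Aut AFa.
move=> u Qu; have Nu := subsetP sQN u Qu.
have Qau : a u \in Q by apply: Aut_closed (AutF_Aut AFa) _ Qu.
have := xfE u Qu; rewrite xy -(fhomJ Ff) // => /injf -> //.
  by rewrite groupJ.
exact: subsetP sQN _ Qau.
Qed.

(** The statement proved by induction is that Aut_F(Q) is induced by N_P(Q) for Q
    fully normalized: this is what the two preceding lemmas consume.  It follows
    from Aut_F(Q) being a p-group since a self-normalizing subgroup of a
    nilpotent group is the whole group, and from the Sylow axiom when Q = P. *)
Lemma fusion_nilpotent_criterion :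
    prime p -> p.-group P ->
    (forall Q, Q \subset P -> 'C_P(Q) \subset Q ->
       (Q \proper P -> 'N_(AutF F Q)(normAut P Q) \subset normAut P Q) ->
     p.-group (AutF F Q)) ->
  fusion_nilpotent F.
Proof.
move=> pr_p pP crit.
have p_normAut Q : p.-group (normAut P Q).
  by apply: morphim_pgroup; apply: pgroupS pP; apply: subsetIl.
have inner n Q : fully_normalized F P Q -> #|P| - #|Q| < n ->
    AutF F Q \subset normAut P Q.
  elim: n Q => // n IHn Q fnQ lt_n; have [sQP _] := fnQ.
  have IH R : fully_normalized F P R -> #|Q| < #|R| -> AutF F R \subset normAut P R.
    move=> fnR ltQR; apply: IHn => //; have [sRP _] := fnR.
    have ltQP := leq_trans ltQR (subset_leq_card sRP).
    exact: leq_trans (ltn_sub2l ltQP ltQR) lt_n.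
  pose A := Group (AutF_group_set F sQP).
  have selfN : Q \proper P -> 'N_A(normAut P Q) \subset normAut P Q.
    by move=> prQP; apply: normAut_self_normalizing.
  have pA : p.-group A.
    have [cQ | ncQ] := boolP ('C_P(Q) \subset Q); first exact: crit.
    apply: AutF_centric => // R fnR ltQR; have [sRP _] := fnR.
    exact: (@pgroupS _ _ (normAut P R) (Group (AutF_group_set F sRP))) (IH R fnR ltQR) _.
  have [/eqP eQP | neQP] := boolP (Q == P :> {set gT}).
    have eQPg : Q = P by apply/val_inj.
    subst Q; apply: subset_trans (_ : conj_aut P @* P \subset _).
      have sylP : p.-Sylow(A) (conj_aut P @* P) := fhom_Sylow F.
      by rewrite -(sub_pHall sylP pA) ?(pHall_sub sylP) //=.
    by apply: morphimS; rewrite subsetI subxx normG.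
  have sSA : normAut P Q \subset A by apply: normAut_sub_AutF.
  have /= <- := nilpotent_sub_norm (pgroup_nil pA) sSA (selfN _) => //.
  by rewrite properEneq neQP.
move=> Q sQP.
have [f Ff fnR] := fully_normalized_fimg F sQP.
apply: contraT => /(AutF_prime_elt sQP)[a AFa [pr_a a_p]].
have [b AFb bE] := AutF_transport Ff AFa.
have p_b : p.-elt b.
  exact: mem_p_elt (p_normAut _) (subsetP (inner _ _ fnR (ltnSn _)) b AFb).
have [_ injf _] := fhom_inj Ff.
have da : #[a] %| #[b] := order_dvd_intertwine injf (AutF_Aut AFa) bE.
by have := pnat_dvd da p_b; rewrite pnatE // inE (negPf a_p).
Qed.

End FusionExtension.

(** * Automorphisms of odd order of two-generated 2-groups *)

Section OddAutomorphism.

Variables (gT : finGroupType) (Q : {group gT}).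
Hypothesis pQ : 2.-group Q.

Lemma Aut_fix_gen (a : {perm gT}) (B : {set gT}) :
  a \in Aut Q -> <<B>> = Q -> {in B, forall u, a u = u} -> a = 1.
Proof.
move=> Aa genB fixB.
have aM := morphicP (Aut_morphic Aa).
have fix_gr : group_set [set u in Q | a u == u].
  apply/group_setP; split=> [|u v].
    rewrite inE group1 -(inj_eq (mulgI (a 1))) /=.
    by rewrite -aM ?group1 // !mulg1.
  case/setIdP=> Qu /eqP au /setIdP[Qv /eqP av].
  by rewrite inE groupM //= aM // au av.
apply: (eq_Aut Aa) => [|u Qu]; first exact: group1.
have: u \in Group fix_gr.
  apply: subsetP u Qu; rewrite -{1}genB gen_subG; apply/subsetP=> u Bu.
  by rewrite inE -genB mem_gen //= fixB.
by rewrite perm1 inE => /andP[_ /eqP].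
Qed.

(** The complement of a subgroup of index 2 has as many elements as the subgroup,
    a power of 2, so a permutation of odd prime order fixes one of them. *)
Lemma index2_fixed_point_outside (a : {perm gT}) (M : {group gT}) :
    a \in Aut Q -> prime #[a] -> #[a] != 2 ->
    M \subset Q -> #|Q : M| = 2 -> {in M, forall u, a u \in M} ->
  exists2 u, u \in Q :\: M & a u = u.
Proof.
move=> Aa pr_a a2 sMQ iMQ Ma.
have cQ := Lagrange sMQ; rewrite iMQ in cQ.
have cD : #|Q :\: M| = #|M|.
  by rewrite cardsD (setIidPr sMQ) -cQ muln2 -addnn addnK.
have aM : a @: M = M.
  apply/eqP; rewrite eqEcard card_imset ?leqnn ?andbT; last exact: perm_inj.
  by apply/subsetP=> _ /imsetP[u Mu ->]; apply: Ma.
have acts_a : [acts <[a]>, on Q :\: M | 'P].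
  rewrite cycle_subG !inE; apply/subsetP=> u /setDP[Qu notMu].
  rewrite !inE /= /aperm (Aut_closed Aa Qu) andbT; apply: contra notMu.
  by rewrite -{1}aM => /imsetP[w Mw /perm_inj->].
have a_gr : #[a].-group <[a]> by rewrite /pgroup -orderE pnat_id.
have := pgroup_fix_mod a_gr acts_a.
have [->|[u]] := set_0Vmem 'Fix_(Q :\: M | 'P)(<[a]>).
  rewrite cards0 mod0n cD => /eqP a_dv.
  have : 2.-nat #[a] := pnat_dvd a_dv (pgroupS sMQ pQ).
  by rewrite pnatE // inE (negPf a2).
case/setIP=> Du /afixP fix_u _; exists u => //.
by have := fix_u a (cycle_id a).
Qed.

(** If a stabilizes M it fixes some u outside M, thus stabilizes the subgroup N
    generated by u and the Frattini subgroup, which has index at most 2.  If N = Q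
    then u generates Q; otherwise a also fixes some v outside N, and u and v
    generate Q.  In both cases a fixes a generating set. *)
Lemma odd_aut_moves_index2 (a : {perm gT}) (M : {group gT}) (x y : gT) :
    <<[set x; y]>> = Q -> a \in Aut Q -> prime #[a] -> #[a] != 2 ->
    M \subset Q -> #|Q : M| = 2 -> {in M, forall u, a u \in M} -> False.
Proof.
move=> genQ Aa pr_a a2 sMQ iMQ Ma.
have a_neq1 : a != 1.
  by apply: contraTneq pr_a => ->; rewrite order1.
have [u /setDP[Qu notMu] au] := index2_fixed_point_outside Aa pr_a a2 sMQ iMQ Ma.
have maxM : maximal M Q by rewrite p_index_maximal // iMQ.
have notPu : u \notin 'Phi(Q) by apply: contra notMu; apply/subsetP/Phi_sub_max.
pose N := ('Phi(Q) <*> <[u]>)%G.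
have sNQ : N \subset Q by rewrite join_subG Phi_sub cycle_subG.
have abE : 2.-abelem (Q / 'Phi(Q)) := Phi_quotient_abelem pQ.
have iPhi : #|Q : 'Phi(Q)| %| 4.
  rewrite -card_quotient ?gFnorm // (card_pgroup (abelem_pgroup abE)).
  rewrite -(rank_abelem abE) -grank_abelian ?(abelem_abelian abE) //.
  apply: (@dvdn_exp2l 2 _ 2); apply: leq_trans (_ : 'm(Q) <= 2).
    by apply: morphim_grank; rewrite gFnorm.
  by rewrite -genQ (leq_trans (grank_min _)) // cards2; case: (_ != _).
have prPN : 'Phi(Q) \proper N.
  rewrite properE joing_subl /=; apply: contra notPu => /subsetP-> //.
  by rewrite (subsetP (joing_subr _ _)) ?cycle_id.
have aPhi : {in 'Phi(Q), forall w, a w \in 'Phi(Q)}.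
  move=> w Pw; have /charP[_ cPhi] := Phi_char Q.
  have := mem_morphim [morphism of autm Aa] (subsetP (Phi_sub Q) w Pw) Pw.
  by rewrite (cPhi _ (injm_autm Aa) (im_autm Aa)) /= autmE.
have [NQ | neqNQ] := eqVneq (N : {set gT}) Q.
  case/eqP: a_neq1; apply: (Aut_fix_gen (B := [set u])) => //.
    by apply: Phi_nongen; rewrite -[RHS]NQ /= joing_idr.
  by move=> _ /set1P->.
have iNQ : #|Q : N| = 2.
  have i1 : 1 < #|Q : N| by rewrite indexg_gt1; apply: contra neqNQ; rewrite eqEsubset sNQ.
  have i2 : 1 < #|N : 'Phi(Q)| by rewrite indexg_gt1; case/andP: prPN.
  have /dvdn_leq := iPhi; rewrite -(Lagrange_index sNQ (proper_sub prPN)).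
  move/(_ isT)/(leq_trans (leq_mul (leqnn _) i2)).
  by rewrite -[4]/(2 * 2)%N leq_pmul2r // => i_le2; apply/eqP; rewrite eqn_leq i_le2.
have Na : {in N, forall w, a w \in N}.
  move=> w; rewrite /= norm_joinEr; last first.
    by rewrite cycle_subG (subsetP (gFnorm _ _)).
  case/mulsgP=> f _ Pf /cycleP[n ->] ->; have Qf := subsetP (Phi_sub Q) f Pf.
  have := morphM (autm_morphism Aa) Qf (groupX n Qu); rewrite /= autmE => ->.
  have := morphX (autm_morphism Aa) n Qu; rewrite /= autmE => ->; rewrite au.
  by rewrite mem_mulg ?aPhi ?mem_cycle.
have [v /setDP[Qv notNv] av] := index2_fixed_point_outside Aa pr_a a2 sNQ iNQ Na.
case/eqP: a_neq1; apply: (Aut_fix_gen (B := [set u; v])) => //; last first.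
  by move=> w /set2P[]->.
apply: Phi_nongen; apply/eqP; rewrite eqEsubset join_subG Phi_sub /=.
rewrite subUset !sub1set Qu Qv /=.
have maxN : maximal N Q by rewrite p_index_maximal // iNQ.
have defQ : N * <[v]> = Q.
  apply: mulg_normal_maximal; rewrite ?cycle_subG //.
  exact: p_maximal_normal pQ maxN.
apply: subset_trans (_ : N * <[v]> \subset _); first by rewrite defQ.
rewrite mul_subG ?cycle_subG ?(subsetP (joing_subr _ _)) ?set22 //.
rewrite join_subG joing_subl cycle_subG (subsetP (joing_subr _ _)) //.
exact: set21.
Qed.

End OddAutomorphism.

(** * Metacyclic 2-groups with an automorphism of odd order *)

Lemma cycle_involution_mem (gT : finGroupType) (u : gT) n (H : {group gT}) :
  #[u] = (2 ^ n.+1)%N -> H \subset <[u]> -> H :!=: 1 -> u ^+ (2 ^ n) \in H.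
Proof.
move=> ou sHu ntH.
have pH : 2.-group H by rewrite (pgroupS sHu) // /pgroup -orderE ou pnatX.
have [_ even_H _] := pgroup_pdiv pH ntH.
rewrite -cycle_subG -(cardSg_cyclic (cycle_cyclic u)) ?cycleX //.
by rewrite -orderE orderXdiv ou ?dvdn_exp2l // expnS mulnK ?expn_gt0.
Qed.

Lemma dvd8_sqr m : 8 %| m * m -> 4 %| m.
Proof.
rewrite /dvdn -modnMm -[m %% 4](@modn_dvdm 8) //.
by case: (m %% 8) (ltn_pmod m (isT : 0 < 8)) => [|[|[|[|[|[|[|[|]]]]]]]].
Qed.

Section MetacyclicOddAutomorphism.

Variables (gT : finGroupType) (Q : {group gT}) (x : gT) (a : {perm gT}).
Hypotheses (pQ : 2.-group Q) (nxQ : <[x]> <| Q) (cycQx : cyclic (Q / <[x]>)).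
Hypotheses (Aa : a \in Aut Q) (pr_a : prime #[a]) (odd_a : #[a] != 2).

Let Qx : x \in Q.
Proof. by rewrite -cycle_subG normal_sub. Qed.

Lemma metacyclic_gen2 : exists y, <<[set x; y]>> = Q.
Proof.
have [yb defQb] := cyclicP cycQx.
have : yb \in Q / <[x]> by rewrite defQb cycle_id.
case/morphimP=> y Ny Qy def_yb; exists y.
apply/eqP; rewrite eqEsubset gen_subG subUset !sub1set Qx Qy /=.
have sxH : <[x]> \subset <<[set x; y]>> by rewrite cycle_subG mem_gen ?set21.
have <- : <[x]> <*> <[y]> = <<[set x; y]>> by rewrite joing_idl joing_idr.
have nxy : <[y]> \subset 'N(<[x]>) by rewrite cycle_subG.
by rewrite norm_joinEr // -quotientSK ?normal_norm // quotient_cycle // -def_yb defQb.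
Qed.

Lemma Aut_moves_index2 (M : {group gT}) :
  M \subset Q -> #|Q : M| = 2 -> {in M, forall u, a u \in M} -> False.
Proof.
have [y genQ] := metacyclic_gen2.
exact: odd_aut_moves_index2 genQ Aa pr_a odd_a.
Qed.

(** Subgroups of Q containing x correspond to subgroups of the cyclic group
    Q / <[x]>. *)
Lemma maximal_over_cycle_unique (M N : {group gT}) :
    maximal M Q -> maximal N Q -> <[x]> \subset M -> <[x]> \subset N ->
  M = N :> {set gT}.
Proof.
move=> maxM maxN sxM sxN.
have [sMQ sNQ] := (maxgroupp maxM, maxgroupp maxN).
have {}sMQ := proper_sub sMQ; have {}sNQ := proper_sub sNQ.
have nxM := normalS sxM sMQ nxQ; have nxN := normalS sxN sNQ nxQ.
apply: (quotient_inj nxM nxN); apply/eqP.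
rewrite (eq_subG_cyclic cycQx) ?quotientS // !card_quotient ?normal_norm //.
have ox := cardG_gt0 <[x]>.
rewrite -(eqn_pmul2l ox) !Lagrange //.
have := p_maximal_index pQ maxM; have := p_maximal_index pQ maxN.
have := Lagrange sMQ; have := Lagrange sNQ => cN cM iN iM.
by rewrite -(eqn_pmul2r (isT : 0 < 2)) -{1}iM -iN cN cM.
Qed.

(** Otherwise x and a x lie in a common maximal subgroup M.  Then M and its preimage
    under a are maximal subgroups containing x, so they coincide, and M is
    stable under a. *)
Lemma gen_Aut_image : <<[set x; a x]>> = Q.
Proof.
have Qax : a x \in Q by apply: Aut_closed.
have sHQ : <<[set x; a x]>> \subset Q by rewrite gen_subG subUset !sub1set Qx.
have [//|[M maxM sHM]] := maximal_exists sHQ.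
have [Mx Max] : x \in M /\ a x \in M.
  by split; apply: (subsetP sHM); rewrite mem_gen ?set21 ?set22.
have sMQ := proper_sub (maxgroupp maxM).
have iMQ := p_maximal_index pQ maxM.
have AV : a^-1 \in Aut Q by rewrite groupV.
pose N := (autm AV @* M)%G.
have sNQ : N \subset Q by have := morphimS (autm_morphism AV) sMQ; rewrite im_autm.
have cNM : #|N| = #|M| by rewrite card_injm ?injm_autm.
have iNQ : #|Q : N| = 2 by rewrite -divgS // cNM divgS.
have maxN : maximal N Q by rewrite p_index_maximal // iNQ.
have Nx : x \in N.
  rewrite -[x](permK a); exact: (mem_morphim (autm_morphism AV) Qax Max).
have eMN : M = N :> {set gT}.
  by apply: maximal_over_cycle_unique; rewrite ?cycle_subG.
case: (Aut_moves_index2 sMQ iMQ) => u Mu; rewrite eMN in Mu.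
case/morphimP: Mu => w Qw Mw ->.
suff -> : a (autm_morphism AV w) = w by [].
exact: permKV.
Qed.

(** If the two cyclic groups meet, they share their involution z.  The power map
    sends x and a x to z, so its image is <[z]> and its kernel has index 2; but
    this kernel is stable under a. *)
Lemma power_morphism_TI e :
    #[x] = (2 ^ e.+1)%N ->
    {in Q &, {morph (fun u => u ^+ (2 ^ e)) : u v / u * v}} ->
  <[x]> :&: <[a x]> = 1.
Proof.
move=> ox powM; apply/eqP; apply: contraT => ntI.
have Qax : a x \in Q by apply: Aut_closed.
have oax : #[a x] = (2 ^ e.+1)%N.
  by rewrite -ox; apply: (order_injm (injm_autm Aa)).
have inv_in (u : gT) : #[u] = (2 ^ e.+1)%N -> #[u ^+ (2 ^ e)] = 2.
  by move=> ou; rewrite orderXdiv ou ?dvdn_exp2l // expnS mulnK ?expn_gt0.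
have Ix := cycle_involution_mem ox (subsetIl _ _) ntI.
have Iy := cycle_involution_mem oax (subsetIr _ _) ntI.
have xy : (a x) ^+ (2 ^ e) = x ^+ (2 ^ e).
  have xIy : (a x) ^+ (2 ^ e) \in <[x ^+ (2 ^ e)]>.
    rewrite -cycle_subG -(cardSg_cyclic (cycle_cyclic x)) ?cycleX //.
      by rewrite -!orderE !inv_in.
    by rewrite cycle_subG; case/setIP: Iy.
  rewrite cycle2g ?inv_in // in xIy; case/set2P: xIy => // y1.
  by have := inv_in _ oax; rewrite y1 order1.
pose h := Morphism powM.
have cyc_h : h @* Q = <[x ^+ (2 ^ e)]>.
  have -> : h @* Q = h @* <<[set x; a x]>> by rewrite gen_Aut_image.
  rewrite morphim_gen /=; last by rewrite subUset !sub1set Qx.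
  rewrite morphimU !morphim_set1 //= xy setUid //.
have sKQ : 'ker h \subset Q by apply: subsetIl.
case: (Aut_moves_index2 sKQ) => [|u /morphpreP[Qu /set1P /= u1]].
  by have := card_morphim h Q; rewrite setIid cyc_h -orderE inv_in.
apply/morphpreP; split; first exact: Aut_closed.
apply/set1P; have /= <- := morphX (autm_morphism Aa) (2 ^ e) Qu.
by rewrite u1; apply: (morph1 (autm_morphism Aa)).
Qed.

(** The commutator c of x and y = a x lies in both normal cyclic subgroups, so it
    is central and generates the derived subgroup.  Writing c = x^m, centrality of
    c gives x^(m * m) = 1; so if x has order at least 8 then 4 divides m, and the
    commutators that appear in (u * v)^(2^(e-1)), where x has order 2^e, vanish.
    The power map is then multiplicative, as it is in the abelian case, and the two
    subgroups meet trivially, which contradicts c <> 1.  Orders 1 and 2 leave no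
    room for a nontrivial c, and order 4 gives the second alternative. *)
Lemma Aut_image_dichotomy :
  (abelian Q /\ <[x]> :&: <[a x]> = 1) \/
  [/\ #[x] = 4, (a x) ^+ 2 \in <[x]> & x ^ a x != x].
Proof.
set y := a x.
have Qy : y \in Q by apply: Aut_closed.
have oy : #[y] = #[x] by exact: (order_injm (injm_autm Aa)).
have genQ : <<[set x; y]>> = Q := gen_Aut_image.
have nyQ : <[y]> <| Q.
  have := morphim_normal (autm_morphism Aa) nxQ.
  by rewrite (im_autm Aa) morphim_cycle //= autmE.
have [e ox] : exists e, #[x] = (2 ^ e)%N.
  by exists (logn 2 #[x]); apply: card_pgroup (mem_p_elt pQ Qx).
have [abQ | nabQ] := boolP (abelian Q).
  left; split=> //; case: e ox => [|e] ox.
    have /eqP := ox; rewrite order_eq1 => /eqP->.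
    by rewrite cycle1 (setIidPl (sub1G _)).
  apply: (power_morphism_TI ox) => u v Qu Qv /=.
  by rewrite expgMn //; apply: (centsP abQ).
right; set c := [~ x, y].
have Ic : c \in <[x]> :&: <[y]>.
  rewrite inE /c {1}commgEl {1}commgEr groupMl ?groupV ?cycle_id //.
  rewrite memJ_norm ?groupV ?cycle_id ?(subsetP (normal_norm nxQ)) //=.
  rewrite groupMr ?cycle_id // memJ_norm ?groupV ?cycle_id //.
  exact: (subsetP (normal_norm nyQ)).
have [/cycleP[m cm] /cycleP[j cj]] := setIP Ic.
have xc : commute x c by rewrite cm; apply: commuteX.
have yc : commute y c by rewrite cj; apply: commuteX.
have defQ : <[x]> <*> <[y]> = Q by rewrite joing_idl joing_idr.
have cQc : c \in 'C(Q).
  by rewrite -genQ cent_gen; apply/centP=> u /set2P[]->; apply: commute_sym.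
have derQ : Q^`(1) = <[c]> by rewrite -defQ der1_joing_cycles // defQ.
have c_neq1 : c != 1.
  by apply: contra nabQ => /eqP c1; apply/derG1P; rewrite derQ c1 cycle1.
have ntI : <[x]> :&: <[y]> != 1.
  by apply: contraNneq c_neq1 => I1; apply/eqP/set1gP; rewrite -I1.
case: e ox => [|[|[|e]]] ox.
- by have /eqP := ox; rewrite order_eq1 => /eqP x1; rewrite /c x1 comm1g eqxx in c_neq1.
- have: c \in <[x]> by case/setIP: Ic.
  rewrite cycle2g // => /set2P[c1|cx]; first by rewrite c1 eqxx in c_neq1.
  by case/negP: c_neq1; apply/commgP; rewrite -cx; apply: commute_sym.
- split=> //; last by rewrite conjg_mulR -/c -{2}[x]mulg1 (inj_eq (mulgI x)).
  have := @cycle_involution_mem _ y 1 (<[x]> :&: <[y]>)%G.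
  by rewrite oy ox subsetIr => /(_ erefl isT ntI)/setIP[].
case/eqP: ntI; apply: (power_morphism_TI ox) => u v Qu Qv /=.
have dv4m : 4 %| m.
  apply: dvd8_sqr; apply: (@dvdn_trans #[x]).
    by rewrite ox (@dvdn_exp2l 2 3).
  rewrite order_dvdn; apply/eqP/(mulgI (x ^+ m)).
  rewrite mulg1 -expgD -mulSn expgM expgS -cm -conjg_mulR -conjXg -cm.
  by apply/conjg_fixP/commgP.
have Dvu : [~ v, u] \in <[c]> by rewrite -derQ mem_commg.
have cvu : [~ v, u] \in 'C(Q).
  by apply: subsetP Dvu; rewrite cycle_subG.
rewrite expMg_Rmul; try by apply/commute_sym/(centP cvu).
suffices ->: [~ v, u] ^+ 'C(2 ^ e.+2, 2) = 1 by rewrite mulg1.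
case/cycleP: Dvu => i ->; rewrite cm -!expgM; apply/eqP; rewrite -order_dvdn ox.
have -> : 'C(2 ^ e.+2, 2) = (2 ^ e.+1 * (2 ^ e.+2).-1)%N.
  by rewrite bin2 {1}expnS -mulnA mul2n doubleK.
case/dvdnP: dv4m => m' ->; apply/dvdnP; exists (m' * i * (2 ^ e.+2).-1)%N.
set K := (2 ^ e.+2).-1; rewrite (expnD 2 2 e.+1) !mulnA (mulnAC m' 4).
by rewrite -(mulnA _ 2 2) (mulnAC _ K 4) (mulnAC _ K).
Qed.

End MetacyclicOddAutomorphism.

(** * Recognizing 2-groups of maximal class *)

Lemma order4_exponent_odd (gT : finGroupType) (v w : gT) i :
  #[v] = 4 -> #[w] = 4 -> w = v ^+ i -> odd i.
Proof.
move=> ov ow wi; apply: contraT => ev_i.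
have: #[w] %| 2.
  rewrite order_dvdn wi -expgM -(even_halfK ev_i) -muln2 -mulnA mulnC expgM.
  by rewrite -[(2 * 2)%N]ov expg_order expg1n.
by rewrite ow.
Qed.

Lemma odd_mod4 i : odd i -> i %% 4 = 1%N \/ i %% 4 = 3.
Proof.
rewrite {1}(divn_eq i 4) oddD oddM andbF /=.
by case: (i %% 4) (ltn_pmod i (isT : 0 < 4)) => [|[|[|[|]]]]; auto.
Qed.

Section MaximalClass.

Variables (gT : finGroupType) (P X : {group gT}).
Hypotheses (pP : 2.-group P) (nXP : X <| P) (cycX : cyclic X).
Hypothesis (cycPX : cyclic (P / X)).

(** The automorphism group of a cyclic group of order 4 has exponent 2. *)
Lemma sq_cent_order4 v r : v \in X -> #[v] = 4 -> r \in P -> v ^ (r ^+ 2) = v.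
Proof.
move=> Xv ov Pr; have Nr := subsetP (normal_norm nXP) r Pr.
have Xvr : v ^ r \in X by rewrite memJ_norm.
have: v ^ r \in <[v]>.
  rewrite -cycle_subG -(cardSg_cyclic cycX) ?cycle_subG //.
  by rewrite -!orderE orderJ.
case/cycleP=> i vr; have odd_i : odd i.
  by apply: (order4_exponent_odd ov) vr; rewrite orderJ.
rewrite expgS expg1 conjgM vr conjXg vr -expgM -[RHS]expg1; apply/eqP.
rewrite eq_expg_mod_order ov -modnMm.
by case: (odd_mod4 odd_i) => ->.
Qed.

(** Squares of P centralize v, as does X, so t is not a square modulo X and
    therefore generates the cyclic 2-group P / X, which has order 2 because t^2
    is in X.  If x generates X then x^t = x^k, and since t moves v, k is 3 modulo 4.  Thus each
    commutation with t only doubles the exponent of x, up to an odd factor, and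
    the lower central series of P descends as slowly as the order of X allows. *)
Lemma maximal_class_criterion t v :
    t \in P -> t \notin X -> t ^+ 2 \in X -> v \in X -> #[v] = 4 -> v ^ t != v ->
  maximal_class 2 P.
Proof.
move=> Pt notXt Xt2 Xv ov vt.
have nXt := subsetP (normal_norm nXP) t Pt.
have genPX : P / X = <[coset X t]>.
  have [wb defPX] := cyclicP cycPX.
  have PXwb : wb \in P / X by rewrite defPX cycle_id.
  have /morphimP[w Nw Pw def_wb] := PXwb.
  have : coset X t \in <[wb]> by rewrite -defPX mem_quotient.
  case/cycleP=> k tk; have [odd_k | ev_k] := boolP (odd k).
    rewrite tk defPX; apply/eqP; rewrite -/(generator _ _) generator_coprime.
    have pwb : 2.-elt wb := mem_p_elt (quotient_pgroup X pP) PXwb.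
    by rewrite /order (card_pgroup pwb) coprimeXl // coprime2n.
  case/negP: vt; pose r := w ^+ k./2.
  have Pr : r \in P by rewrite groupX.
  have Xz : t * r ^- 2 \in X.
    apply: coset_idr; first by rewrite groupM ?groupV ?groupX.
    rewrite morphM ?groupV ?groupX //= tk morphV ?groupX //= !morphX ?groupX //=.
    rewrite -def_wb -expgM muln2 even_halfK // mulgV //.
  have -> : t = t * r ^- 2 * r ^+ 2 by rewrite mulgKV.
  rewrite conjgM [v ^ _](_ : _ = v) ?sq_cent_order4 //.
  by apply/conjg_fixP/commgP; apply: (centsP (cyclic_abelian cycX)).
have cPX : #|P / X| = 2.
  rewrite genPX -orderE; apply: nt_prime_order => //.
    by rewrite -morphX //= coset_id.
  by apply: contra notXt => /eqP/(coset_idr nXt).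
have [x defX] := cyclicP cycX.
have Xx : x \in X by rewrite defX cycle_id.
have Px : x \in P by rewrite (subsetP (normal_sub nXP)).
have [m cX] := p_natP (pgroupS (normal_sub nXP) pP).
have ox : #[x] = (2 ^ m)%N by rewrite /order -defX.
have m_gt1 : 1 < m.
  rewrite -(@dvdn_Pexp2l 2) // -cX -[(2 ^ 2)%N]ov; exact: order_dvdG.
have cP : #|P| = (2 ^ m.+1)%N.
  by rewrite -(Lagrange (normal_sub nXP)) -card_quotient ?normal_norm // cPX cX expnSr.
have Xxt : x ^ t \in X by rewrite memJ_norm.
have [k xt] : exists k, x ^ t = x ^+ k by apply/cycleP; rewrite -defX.
have [i vi] : exists i, v = x ^+ i by apply/cycleP; rewrite -defX.
have vtk : v ^ t = v ^+ k by rewrite vi conjXg xt -!expgM mulnC.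
have odd_k : odd k.
  by apply: (order4_exponent_odd ov) vtk; rewrite orderJ.
have k3 : k %% 4 = 3.
  have : v ^+ k != v ^+ 1 by rewrite -vtk expg1.
  by rewrite eq_expg_mod_order ov; case: (odd_mod4 odd_k) => ->.
have lcn_x j : x ^+ (2 ^ j) \in 'L_j.+1(P).
  elim: j => [|j IHj]; first by rewrite lcn1 expg1.
  have : [~ x ^+ (2 ^ j), t] \in 'L_j.+2(P) by rewrite lcnSn mem_commg.
  rewrite commgEl conjXg xt -expgM.
  have -> : (k * 2 ^ j = 2 ^ j + 2 ^ j.+1 * (k %/ 4).*2.+1)%N.
    rewrite {1}(divn_eq k 4) k3 expnSr -mulnA -{2}[(2 ^ j)%N]muln1 -mulnDr mulnC.
    by congr (_ * _)%N; rewrite mul2n doubleS -!muln2 -mulnA addnC.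
  rewrite expgD mulKg expgM -cycle_subG.
  suffices <- : <[x ^+ (2 ^ j.+1)]> = <[x ^+ (2 ^ j.+1) ^+ (k %/ 4).*2.+1]>.
    by rewrite cycle_subG.
  apply/eqP; rewrite -/(generator _ _) generator_coprime.
  have pxj : 2.-elt (x ^+ (2 ^ j.+1)) by apply: (mem_p_elt pP); rewrite groupX.
  by rewrite /order (card_pgroup pxj) coprimeXl // coprime2n /= odd_double.
exists m.+1; split=> //; apply/eqP; rewrite eqn_leq /=.
have nilP := pgroup_nil pP; apply/andP; split.
  have := nil_class_pgroup pP; rewrite cP pfactorK //=.
  by rewrite (maxn_idPr _) // ltnW.
rewrite leqNgt; apply/negP; rewrite -{1}(ltn_predK m_gt1) ltnS.
move/(lcn_nil_classP _ nilP)=> Lm; have := lcn_x m.-1.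
rewrite Lm => /set1gP/eqP; rewrite -order_dvdn ox dvdn_Pexp2l //.
by case: (m) m_gt1 => // m'; rewrite ltnn.
Qed.

End MaximalClass.

(** * Homocyclic subgroups containing their centralizer *)

Lemma odd_expg_eq1 (gT : finGroupType) (x : gT) n :
  2.-elt x -> odd n -> x ^+ n = 1 -> x = 1.
Proof.
move=> px odd_n xn; apply/eqP; rewrite -order_eq1.
have : #[x] %| n by rewrite order_dvdn xn.
have [[|k] ->] := p_natP px; first by [].
by move/(dvdn_trans (dvdn_exp (ltn0Sn k) (dvdnn 2))); rewrite dvdn2 odd_n.
Qed.

Section CriticalSubgroup.

Variables (gT : finGroupType) (P X : {group gT}).
Hypotheses (pP : 2.-group P) (nXP : X <| P) (cycX : cyclic X).
Hypothesis (cycPX : cyclic (P / X)).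

Let nX g : g \in P -> g \in 'N(X).
Proof. exact: subsetP (normal_norm nXP) g. Qed.

Variables (Q : {group gT}) (x : gT).
Hypotheses (sQP : Q \subset P) (IX : X :&: Q = <[x]>).

Let xXQ : x \in X /\ x \in Q.
Proof. by apply/setIP; rewrite IX cycle_id. Qed.

Lemma metacyclic_inter_normal : <[x]> <| Q.
Proof. by rewrite -IX setIC; apply: normalGI nXP. Qed.

Lemma metacyclic_inter_quotient : cyclic (Q / <[x]>).
Proof.
have nXQ := subset_trans sQP (normal_norm nXP).
rewrite -IX (isog_cyclic (second_isog nXQ)).
by apply: cyclicS cycPX; rewrite quotientS.
Qed.

(** The quotient P / X is abelian and g normalizes Q. *)
Lemma commg_mem_inter u g : u \in Q -> g \in 'N_P(Q) -> [~ u, g] \in <[x]>.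
Proof.
move=> Qu /setIP[Pg Ng]; rewrite -IX inE; apply/andP; split; last first.
  by rewrite commgEl groupMl ?groupV // memJ_norm.
have abPX := cyclic_abelian cycPX.
apply: subsetP (_ : [~ u, g] \in P^`(1)); last first.
  by rewrite mem_commg // (subsetP sQP).
by apply: der1_min; rewrite ?normal_norm.
Qed.

Hypothesis cQ : 'C_P(Q) \subset Q.
Hypothesis prQ : Q \proper P.

(** If X has an element v of order 4, the criterion applies to y and v: were v to
    commute with y it would centralize Q, hence lie in Q, whose intersection with X
    has order 2 only.  If X has order 2 it is central, so P is abelian
    and is its own centralizer, contained in Q. *)
Lemma centric_four_group y :
    <<[set x; y]>> = Q -> #[x] = 2 -> #[y] = 2 -> commute x y ->
    <[x]> :&: <[y]> = 1 ->
  maximal_class 2 P.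
Proof.
move=> genQ ox oy cxy TI; have [Xx _] := xXQ.
have Qy : y \in Q by rewrite -genQ mem_gen ?set22.
have notXy : y \notin X.
  apply/negP=> Xy; have : y \in <[x]> by rewrite -IX inE Xy.
  move=> xy; have : y \in <[x]> :&: <[y]> by rewrite inE xy cycle_id.
  by rewrite TI => /set1gP y1; rewrite y1 order1 in oy.
have [w defX] := cyclicP cycX.
have [m cX] := p_natP (pgroupS (normal_sub nXP) pP).
have ow : #[w] = (2 ^ m)%N by rewrite /order -defX.
have Xw : w \in X by rewrite defX cycle_id.
case: m cX ow => [|[|m]] cX ow.
- by have := order_dvdG Xx; rewrite ox cX.
- have Xx_eq : X = <[x]> :> {set gT}.
    by apply/eqP; rewrite eq_sym eqEcard cycle_subG Xx cX -ox leqnn.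
  have ZX : X \subset 'Z(P).
    rewrite subsetI normal_sub //= Xx_eq cycle_subG; apply/centP=> g Pg.
    have : x ^ g \in X by rewrite memJ_norm ?nX.
    rewrite Xx_eq cycle2g // => /set2P[xg1|xg].
      by have := orderJ x g; rewrite xg1 order1 ox.
    by apply/commgP/conjg_fixP.
  have abP := cyclic_factor_abelian ZX cycPX.
  case/negP: (proper_subn prQ); apply: subset_trans cQ.
  by rewrite subsetI subxx (subset_trans abP) ?centS.
pose v := w ^+ (2 ^ m).
have ov : #[v] = 4.
  by rewrite orderXdiv ow ?dvdn_exp2l ?(expnD 2 2 m) ?mulnK ?expn_gt0 // ltnW.
have Xv : v \in X by rewrite groupX.
apply: (maximal_class_criterion pP nXP cycX cycPX (t := y) (v := v)) => //.
- exact: subsetP sQP y Qy.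
- by rewrite -oy expg_order.
apply/negP=> /eqP/conjg_fixP/commgP cvy.
have Qv : v \in Q.
  apply: (subsetP cQ); rewrite inE (subsetP (normal_sub nXP)) //=.
  rewrite -genQ cent_gen; apply/centP=> u /set2P[]-> //.
  exact: (centsP (cyclic_abelian cycX)).
have : v \in <[x]> by rewrite -IX inE Xv.
by move/order_dvdG; rewrite ov -orderE ox.
Qed.

Lemma sq_mem_Phi u : u \in Q -> u ^+ 2 \in 'Phi(Q).
Proof.
move=> Qu; rewrite (Phi_joing (pgroupS sQP pP)).
rewrite (subsetP (joing_subr _ _)) // -[2]expn1.
by apply: Mho_p_elt => //; apply: mem_p_elt (pgroupS sQP pP) Qu.
Qed.

Lemma even_expg_mem_Phi u n : u \in Q -> ~~ odd n -> u ^+ n \in 'Phi(Q).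
Proof.
move=> Qu ev; rewrite -(even_halfK ev) -muln2 expgM.
by apply: sq_mem_Phi; rewrite groupX.
Qed.

Variables (A : {group {perm gT}}) (a : {perm gT}).
Hypotheses (sAQ : A \subset Aut Q) (sSA : normAut P Q \subset A).
Hypothesis (selfS : 'N_A(normAut P Q) \subset normAut P Q).
Hypotheses (Aa : a \in A) (pr_a : prime #[a]) (odd_a : #[a] != 2).
Hypotheses (abQ : abelian Q) (TI : <[x]> :&: <[a x]> = 1).

Let AutA s : s \in A -> s \in Aut Q. Proof. exact: subsetP sAQ s. Qed.
Let Qa s u : s \in A -> u \in Q -> s u \in Q.
Proof. by move=> As; apply: Aut_closed (AutA As) u. Qed.
Let sM s : s \in A -> {in Q &, {morph s : u v / u * v}}.
Proof. by move=> As; apply/morphicP/Aut_morphic/AutA. Qed.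
Let sV s u : s \in A -> u \in Q -> s u^-1 = (s u)^-1.
Proof. by move=> As; apply: (morphV (autm_morphism (AutA As))). Qed.
Let sX s n u : s \in A -> u \in Q -> s (u ^+ n) = s u ^+ n.
Proof. by move=> As; apply: (morphX (autm_morphism (AutA As))). Qed.

Let inA s u : s \in A -> u \in 'Phi(Q) -> s u \in 'Phi(Q).
Proof.
move=> As Pu; have /charP[_ cPhi] := Phi_char Q.
rewrite -(cPhi _ (injm_autm (AutA As)) (im_autm (AutA As))).
exact: (mem_morphim (autm_morphism (AutA As)) (subsetP (Phi_sub Q) u Pu) Pu).
Qed.

Definition Phi_kernel : {set {perm gT}} :=
  [set s in A | [forall u in Q, u^-1 * s u \in 'Phi(Q)]].

Lemma Phi_kernelP s : reflect (s \in A /\ {in Q, forall u, u^-1 * s u \in 'Phi(Q)})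
                              (s \in Phi_kernel).
Proof. by rewrite inE; apply: (iffP andP) => [][-> /forall_inP]. Qed.

Lemma Phi_kernel_group_set : group_set Phi_kernel.
Proof.
apply/group_setP; split=> [|s t /Phi_kernelP[As sP] /Phi_kernelP[At tP]].
  by apply/Phi_kernelP; split=> // u Qu; rewrite perm1 mulVg.
apply/Phi_kernelP; split=> [|u Qu]; first exact: groupM.
by rewrite permM -(mulKVg (s u) (t (s u))) mulgA groupM ?sP ?tP ?Qa.
Qed.
Canonical Phi_kernel_group := Group Phi_kernel_group_set.

Lemma Phi_kernelJ s t : s \in Phi_kernel -> t \in A -> s ^ t \in Phi_kernel.
Proof.
case/Phi_kernelP=> As sP At; apply/Phi_kernelP; split=> [|u Qu].
  by rewrite groupJ.
have AtV : t^-1 \in A by rewrite groupV.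
have Qw := Qa AtV Qu; set w := t^-1 u in Qw.
have -> : u = t w by rewrite permKV.
by rewrite permJ -sV // -sM ?groupV ?Qa // inA ?sP.
Qed.

(** An element of odd prime order acting trivially on the Frattini quotient would
    stabilize all subgroups of index 2. *)
Lemma Phi_kernel_pgroup : 2.-group Phi_kernel.
Proof.
apply: contraT => /not_pgroup_prime_elt[s /Phi_kernelP[As sP] [pr_s s2]].
have pQ := pgroupS sQP pP.
have ntQ : Q :!=: 1.
  apply: contraTneq pr_s => Q1; suff ->: s = 1 by rewrite order1.
  apply: (eq_Aut (AutA As)); first exact: group1.
  move=> u; rewrite Q1 => /set1gP->; rewrite perm1.
  exact: (morph1 (autm_morphism (AutA As))).
have [// | [M maxM _]] := maximal_exists (sub1G Q).
  by move=> Q1; case/eqP: ntQ.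
case: (Aut_moves_index2 pQ metacyclic_inter_normal metacyclic_inter_quotient
          (AutA As) pr_s s2 (M := M)).
- exact: proper_sub (maxgroupp maxM).
- exact: p_maximal_index pQ maxM.
move=> u Mu; have Qu := subsetP (proper_sub (maxgroupp maxM)) u Mu.
by rewrite -(mulKVg u (s u)) groupM // (subsetP (Phi_sub_max maxM)) ?sP.
Qed.

(** The product of the kernel with [normAut P Q] is a 2-group in which
    [normAut P Q] is self-normalizing. *)
Lemma Phi_kernel_inner : Phi_kernel \subset normAut P Q.
Proof.
have sKA : Phi_kernel \subset A by apply/subsetP=> s /Phi_kernelP[].
have nKA : A \subset 'N(Phi_kernel).
  apply/normsP=> t At; apply/eqP; rewrite eqEcard cardJg leqnn andbT.
  by apply/subsetP=> _ /imsetP[s Ks ->]; apply: Phi_kernelJ.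
pose G := (Phi_kernel <*> normAut P Q)%G.
have pG : 2.-group G.
  rewrite /= norm_joinEr ?(subset_trans sSA) // pgroupM Phi_kernel_pgroup.
  by apply: morphim_pgroup; apply: pgroupS pP; apply: subsetIl.
have <- : G = normAut P Q :> {set _}.
  apply: (nilpotent_sub_norm (pgroup_nil pG)); first exact: joing_subr.
  by apply: subset_trans selfS; rewrite setSI // join_subG sKA.
exact: joing_subl.
Qed.

(** Automorphisms induced by N_P(Q) act trivially on Q / <[x]>.  Since the kernel is
    normalized by a, its elements also act trivially on Q / <[a x]>, and the two
    cyclic groups intersect trivially. *)
Lemma Phi_kernel_trivial : Phi_kernel = 1.
Proof.
apply/trivgP/subsetP=> s Ks; apply/set1gP.
have [As _] := Phi_kernelP _ Ks.
have moves t u : t \in Phi_kernel -> u \in Q -> u^-1 * t u \in <[x]>.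
  move=> Kt Qu; have /normAutP[g [Ng _ tE]] := subsetP Phi_kernel_inner t Kt.
  by rewrite tE // -commgEl commg_mem_inter.
apply: (eq_Aut (AutA As)) => [|u Qu]; first exact: group1.
have AaV : a^-1 \in A by rewrite groupV.
have Qw := Qa AaV Qu; set w := a^-1 u in Qw.
have uw : u = a w by rewrite permKV.
have axE : u^-1 * s u \in <[a x]>.
  have := moves _ _ (Phi_kernelJ Ks AaV) Qw.
  have -> : (s ^ a^-1) w = a^-1 (s u) by rewrite permJ.
  case/cycleP=> i wi; have [_ Qx] := xXQ.
  rewrite {1}uw -sV // -[s u](permKV a) -sM ?groupV ?Qa //.
  by rewrite wi sX // mem_cycle.
have : u^-1 * s u \in <[x]> :&: <[a x]> by rewrite inE moves.
by rewrite TI perm1 => /set1gP/(canRL (mulKg _)) ->; rewrite invgK mulg1.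
Qed.

(** Let g normalize Q without belonging to it, x^g = x^k and y^g = y x^i with
    y = a x.  As k is odd, g^2 acts trivially on the Frattini quotient, hence
    trivially, so g^2 is in Q.  As g does not act trivially, i is odd, and y^(g^2) = y
    then gives k = -1.  In the cyclic 2-group P / X, one of the images of g
    and y is a power of the other.  A power of y times an element of X centralizes x,
    and so cannot be g; the same happens if y = g^n z with n odd, as then y would
    invert x.  If n is even, z is a power x^l, and conjugation by g shows that
    i = - 2 l, contrary to i being odd. *)
Lemma homocyclic_critical_contra : 2 < #[x] -> False.
Proof.
move=> ox; have [Xx Qx] := xXQ.
have pQ := pgroupS sQP pP.
have nxQ := metacyclic_inter_normal.
have defQ : <[x]> * <[a x]> = Q.
  rewrite -norm_joinEr; last first.
    by rewrite cycle_subG (subsetP (normal_norm nxQ)) ?Qa.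
  rewrite joing_idl joing_idr.
  exact: gen_Aut_image pQ nxQ metacyclic_inter_quotient (AutA Aa) pr_a odd_a.
set y := a x in defQ; have Qy : y \in Q by apply: Qa.
have [g Ng notQg] : exists2 g, g \in 'N_P(Q) & g \notin Q.
  by apply/subsetPn; rewrite proper_subn // nilpotent_proper_norm ?(pgroup_nil pP).
have [Pg NQg] := setIP Ng.
have [k xg] : exists k, x ^ g = x ^+ k.
  by apply/cycleP; rewrite -IX inE !memJ_norm ?nX ?Xx.
have odd_k : odd k.
  apply: contraT => ev_k; have [e oxe] := p_natP (mem_p_elt pQ Qx).
  case: e oxe => [|e] oxe; first by rewrite oxe in ox.
  have : (x ^ g) ^+ (2 ^ e) == 1.
    rewrite xg -(even_halfK ev_k) -muln2 -expgM -mulnA -expnS -oxe mulnC.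
    by rewrite expgM expg_order expg1n.
  by rewrite -order_dvdn orderJ oxe dvdn_Pexp2l // ltnn.
have Sg : conj_aut Q g \in normAut P Q by rewrite mem_morphim.
have Ag := subsetP sSA _ Sg.
have gE u : u \in Q -> conj_aut Q g u = u ^ g by apply: norm_conj_autE.
have fix_trivial s : s \in Phi_kernel -> {in Q, forall u, s u = u}.
  by rewrite Phi_kernel_trivial => /set1gP-> u _; rewrite perm1.
have Qg2 : g ^+ 2 \in Q.
  apply: (subsetP cQ); rewrite inE groupX //=; apply/centP=> u Qu.
  apply/commute_sym/commgP/conjg_fixP; rewrite expgS expg1 conjgM.
  have Kg2 : conj_aut Q g ^+ 2 \in Phi_kernel.
    apply/Phi_kernelP; split=> [|w Qw]; first by rewrite groupX.
    rewrite expgS expg1 permM !gE ?memJ_norm //.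
    have /cycleP[j wgj] := commg_mem_inter Qw Ng.
    rewrite [w ^ g]conjg_mulR wgj conjMg conjXg xg conjg_mulR wgj !mulgA mulVg mul1g.
    rewrite -expgM -expgD; apply: even_expg_mem_Phi => //.
    by rewrite oddD oddM odd_k addbb.
  by rewrite -{2}(fix_trivial _ Kg2 u Qu) expgS expg1 permM !gE ?memJ_norm.
have /cycleP[i ygi] := commg_mem_inter Qy Ng.
have yg : y ^ g = y * x ^+ i by rewrite conjg_mulR ygi.
have odd_i : odd i.
  apply: contraR notQg => ev_i; apply: (subsetP cQ); rewrite inE Pg.
  apply/centP=> u Qu; apply/commute_sym/commgP/conjg_fixP; rewrite -gE //.
  apply: fix_trivial Qu; apply/Phi_kernelP; split=> // w Qw; rewrite gE //.
  move: (Qw); rewrite -{1}defQ => /mulsgP[xm yn /cycleP[m xmE] /cycleP[n ynE] ->].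
  have [Qxm Qyn] : xm \in Q /\ yn \in Q by rewrite xmE ynE !groupX.
  have -> : (xm * yn)^-1 * (xm * yn) ^ g = xm^-1 * xm ^ g * (yn^-1 * yn ^ g).
    have cW : commute yn^-1 (xm^-1 * xm ^ g).
      by apply: (centsP abQ); rewrite ?groupV //= groupM ?groupV // memJ_norm.
    by rewrite conjMg invMg -mulgA [xm^-1 * (_ * _)]mulgA mulgA cW -mulgA.
  apply: groupM.
    rewrite xmE conjXg xg -expgM -(odd_double_half k) odd_k mulnDl mul1n expgD mulKg.
    by apply: even_expg_mem_Phi => //; rewrite oddM odd_double.
  rewrite ynE conjXg yg expgMn; last by apply: (centsP abQ); rewrite ?groupX.
  by rewrite mulKg -expgM; apply: even_expg_mem_Phi; rewrite // oddM negb_and ev_i.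
have fixQ z w : z \in Q -> w \in Q -> z ^ w = z.
  by move=> Qz Qw; apply/conjg_fixP/commgP; apply: (centsP abQ).
have xg_inv : x ^ g = x^-1.
  have px : 2.-elt (x ^+ k.+1) by apply: (mem_p_elt pQ); rewrite groupX.
  rewrite xg; apply/(mulgI x); rewrite mulgV -expgS.
  apply: (odd_expg_eq1 px odd_i); apply/(mulgI y).
  have ygg : (y ^ g) ^ g = y by rewrite -conjgM (fixQ y (g * g)).
  rewrite yg conjMg yg conjXg xg -mulgA -!expgM -expgD in ygg.
  by rewrite -expgM mulSn ygg mulg1.
have notCg : x ^ g != x.
  apply: contraTneq ox => xgx; rewrite -leqNgt dvdn_leq // order_dvdn.
  by rewrite expgS expg1 -{1}xgx xg_inv mulVg.
have [wb defPX] := cyclicP cycPX.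
have Py := subsetP sQP y Qy.
have quo (u v : gT) : u \in P -> v \in P -> coset X u \in <[coset X v]> ->
    exists n, exists2 z, z \in X & u = v ^+ n * z.
  move=> Pu Pv /cycleP[n un]; exists n, (v ^- n * u); last by rewrite mulKVg.
  have [Nu Nv] := (nX Pu, nX Pv).
  apply: coset_idr; first by rewrite groupM ?groupV ?groupX.
  by rewrite morphM ?groupV ?groupX //= un morphV ?groupX //= morphX // mulVg.
have fixX z : z \in X -> x ^ z = x.
  by move=> Xz; apply/conjg_fixP/commgP; apply: (centsP (cyclic_abelian cycX)).
have [] : coset X g \in <[coset X y]> \/ coset X y \in <[coset X g]>.
- have PXg : coset X g \in P / X by rewrite mem_quotient.
  have PXy : coset X y \in P / X by rewrite mem_quotient.
  have pPX := quotient_pgroup X pP.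
  have [i1 og] := p_natP (mem_p_elt pPX PXg).
  have [i2 oy] := p_natP (mem_p_elt pPX PXy).
  have chain (u v : coset_of X) :
      u \in P / X -> v \in P / X -> #[u] %| #[v] -> u \in <[v]>.
    move=> PXu PXv dv_uv.
    by rewrite -cycle_subG -(cardSg_cyclic cycPX) ?cycle_subG.
  by case/orP: (leq_total i1 i2) => le_i; [left | right];
    apply: chain; rewrite // og oy dvdn_exp2l.
- case/quo=> // n [z Xz gE']; case/eqP: notCg.
  by rewrite gE' conjgM (fixQ x (y ^+ n)) ?groupX // fixX.
case/quo=> // n [z Xz yE]; have [odd_n | ev_n] := boolP (odd n).
  case/eqP: notCg; rewrite -[RHS](fixQ x y) // yE conjgM -(odd_double_half n) odd_n.
  rewrite expgD expg1 conjgM -muln2 mulnC expgM xg_inv.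
  have Qgh : g ^+ 2 ^+ n./2 \in Q by apply: groupX.
  rewrite (fixQ x^-1 _ _ Qgh) ?groupV //.
  by rewrite conjVg fixX.
have Qgn : g ^+ n \in Q by rewrite -(even_halfK ev_n) -muln2 mulnC expgM groupX.
have /cycleP[l zl] : z \in <[x]>.
  by rewrite -IX inE Xz -(mulKg (g ^+ n) z) -yE groupM ?groupV.
have : x ^+ (i + l.*2) = 1.
  have gg : g ^ g = g by rewrite conjgE mulKg.
  have := yg; rewrite yE zl conjMg !conjXg gg xg_inv -mulgA => /mulgI xl.
  by rewrite -addnn addnC -addnA 2!expgD -xl expVgn mulgV.
move/odd_expg_eq1 => x1; rewrite x1 ?order1 // in ox.
  exact: mem_p_elt pQ Qx.
by rewrite oddD odd_i odd_double.
Qed.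

End CriticalSubgroup.

(** * Nilpotency of the fusion systems *)

Unset Implicit Arguments.

Theorem theorem1 (gT : finGroupType) (P : {group gT}) :
  2.-group P -> metacyclic P -> ~ maximal_class 2 P -> ~ homocyclic2 P ->
  forall F : fusion_system 2 P, fusion_nilpotent F.
Proof.
move=> pP /existsP[X /and3P[cycX nXP cycPX]] not_max not_homo F.
apply: fusion_nilpotent_criterion => // Q sQP cQ selfS.
apply: contraT => /(AutF_prime_elt sQP)[a AFa [pr_a odd_a]].
have Aa := AutF_Aut AFa; have pQ := pgroupS sQP pP.
have [x IX] : exists x, X :&: Q = <[x]>.
  by apply/cyclicP; apply: cyclicS cycX; apply: subsetIl.
have nxQ := metacyclic_inter_normal nXP sQP IX.
have cycQx := metacyclic_inter_quotient nXP cycPX sQP IX.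
have genQ := gen_Aut_image pQ nxQ cycQx Aa pr_a odd_a.
have [Xx Qx] : x \in X /\ x \in Q by apply/setIP; rewrite IX cycle_id.
have oax : #[a x] = #[x] by apply: (order_injm (injm_autm Aa)).
have Qax : a x \in Q by apply: Aut_closed.
have [[abQ TI] | [ox ax2 xax]] := Aut_image_dichotomy pQ nxQ cycQx Aa pr_a odd_a.
  have defQ : <[x]> \x <[a x]> = Q.
    rewrite dprodEY //; first by rewrite joing_idl joing_idr.
    by rewrite (centsS _ (subset_trans _ abQ)) ?cycle_subG.
  have [eQP | neqQP] := eqVneq (Q : {set gT}) P.
    case: not_homo; exists <[x]>%G, <[a x]>%G; rewrite !cycle_cyclic -eQP; split=> //.
    by rewrite isog_cyclic_card /= ?cycle_cyclic //= -!orderE oax.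
  have prQ : Q \proper P by rewrite properEneq neqQP.
  have [ox | ] := ltnP 2 #[x].
    have [] := homocyclic_critical_contra pP nXP cycX cycPX sQP IX cQ prQ
      (A := Group (AutF_group_set F sQP)) _ (normAut_sub_AutF F sQP) (selfS prQ)
      AFa pr_a odd_a abQ TI ox.
    by apply/subsetP=> s /AutF_Aut.
  rewrite leq_eqVlt ltnS => /orP[/eqP ox | x1].
    case: not_max; apply: (centric_four_group pP nXP cycX cycPX sQP IX cQ prQ genQ) => //.
      by rewrite oax.
    exact: (centsP abQ).
  have xE : x = 1 by apply/eqP; rewrite -order_eq1 eqn_leq x1 order_gt0.
  have a11 : a 1 = 1 by apply: (morph1 (autm_morphism Aa)).
  have a1 : a = 1.
    by apply: (Aut_fix_gen Aa genQ) => u /set2P[]->; rewrite xE !a11.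
  by rewrite a1 order1 in pr_a.
case: not_max; apply: (maximal_class_criterion pP nXP cycX cycPX _ _ _ Xx ox xax).
- exact: subsetP sQP _ Qax.
- apply: contra xax => Xax; apply/eqP/conjg_fixP/commgP.
  exact: (centsP (cyclic_abelian cycX)).
- by apply: subsetP ax2; rewrite cycle_subG.
Qed.
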